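(* Let $r$ be a positive integer, let $d = 2^r$, and let $f(x) = x(dx - 1) \in \mathbb{Z}[x]$. Then for every positive integer $n$, $D_f(n) = 2^{\lceil \log_2 n \rceil}$.
   Context: For $f \in \mathbb{Z}[x]$ and $n \in \mathbb{Z}^{+}$, the discriminator $D_f(n)$ is the smallest positive integer $m$ such that $f(1), f(2), \ldots, f(n)$ are pairwise distinct modulo $m$; if no such $m$ exists, $D_f(n) = \infty$. *)

(* Defs.v *)
From mathcomp Require Import all_boot all_order all_algebra.
From mathcomp Require Import boolp.

Set Implicit Arguments.
Unset Strict Implicit.
Unset Printing Implicit Defensive.

Import GRing.Theory.
Local Open Scope ring_scope.

(* For m > 0, %% is the least nonnegative residue, so equality in the list is
   congruence modulo m. *)
Definition discriminates (f : {poly int}) (n m : nat) : bool :=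
  (0 < m)%N && uniq [seq (f.[i%:Z] %% m%:Z)%Z | i <- iota 1 n].

(* The value lies in Z^+ extended with infinity: [None] stands for infinity. *)
Definition discriminator (f : {poly int}) (n : nat) : option nat :=
  match pselect (exists m, discriminates f n m) with
  | left exm => Some (ex_minn exm)
  | right _ => None
  end.

(* Main.v *)
Require Import Defs.
From mathcomp Require Import all_boot all_order all_algebra.
From mathcomp Require Import boolp zify ring.

(** Write [f i - f j = (i - j) (d (i + j) - 1)], whose second factor is odd.
    Hence [2 ^ e] separates any [2 ^ e] consecutive arguments.  Conversely let
    [2 ^ k < n] and [m = 2 ^ a * q < 2 ^ k.+1] with [q] odd, so [m <= 2 n - 3].
    If [q = 1], the arguments [1] and [1 + 2 ^ a] collide.  Otherwise a collision
    is found by making [q] divide [d (i + j) - 1] and [2 ^ a] divide [i - j]: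
    for [a = 0] the sums [i + j] cover [3, 2 n - 1]; for [a > 0] take
    [i = j + 2 ^ a], where [j] has [n - 2 ^ a >= q] possible values because
    [(2 ^ a - 2) (q - 2) >= 0]. *)

Import GRing.Theory.
Local Open Scope ring_scope.

Lemma discriminatesP (f : {poly int}) (n m : nat) :
  reflect ((0 < m)%N /\ forall i j : nat, (0 < j)%N -> (j < i)%N -> (i <= n)%N ->
            ~~ (m%:Z %| f.[i%:Z] - f.[j%:Z])%Z)
          (discriminates f n m).
Proof.
rewrite /discriminates; case: (posnP m) => [->|m_gt0] /=; first by constructor; case.
apply: (iffP idP) => [f_uniq | [_ f_inj]].
  split=> // i j j_gt0 ltji lein; apply/negP; rewrite -eqz_mod_dvd => /eqP eqf.
  have /(_ i.-1 j.-1) := uniqP 0 f_uniq.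
  rewrite !inE !size_map size_iota.
  rewrite !(nth_map 0%N) ?size_iota ?nth_iota; try lia.
  by rewrite !add1n !prednK; [move=> /(_ _ _ eqf); lia | lia | lia].
rewrite map_inj_in_uniq ?iota_uniq // => i j; rewrite !mem_iota => Hi Hj /eqP.
case: (ltngtP i j) => // ltij; first rewrite eq_sym.
  by rewrite eqz_mod_dvd; apply: contraTeq => _; apply: f_inj; lia.
by rewrite eqz_mod_dvd; apply: contraTeq => _; apply: f_inj; lia.
Qed.

(** By Bezout [c] has an inverse [u] modulo [q], so the solutions form the residue class of [u * b],
    which meets any [q] consecutive integers. *)
Lemma linear_cong_window (q c : nat) (b : int) (A : nat) :
  (0 < q)%N -> coprime q c ->
  exists2 j : nat, (A <= j < A + q)%N & (q%:Z %| c%:Z * j%:Z - b)%Z.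
Proof.
move=> q_gt0 co_qc.
have /coprimezP[[v u] /= uvP] : coprimez q%:Z c%:Z by rewrite coprimezE.
have q_neq0 : q%:Z != 0 by lia.
have rem_ge0 := modz_ge0 (u * b - A%:Z) q_neq0.
have rem_lt : ((u * b - A%:Z) %% q%:Z)%Z < q%:Z by apply: ltz_pmod; lia.
exists (A + `|((u * b - A%:Z) %% q%:Z)%Z|)%N; first by lia.
rewrite PoszD gez0_abs // /modz.
apply/dvdzP; exists (- v * b - c%:Z * ((u * b - A%:Z) %/ q%:Z)%Z).
rewrite -[X in _ - X]mul1r -uvP; ring.
Qed.

Section Quadratic.

Variable d : nat.
Let f : {poly int} := 'X * (d%:Z *: 'X - 1).

Lemma quadratic_diff (i j : int) :
  f.[i] - f.[j] = (i - j) * (d%:Z * (i + j) - 1).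
Proof. rewrite /f !hornerE; ring. Qed.

Lemma discriminates_pow2 (n e : nat) :
  ~~ odd d -> (n <= 2 ^ e)%N -> discriminates f n (2 ^ e).
Proof.
move=> d_even le_n; apply/discriminatesP; split=> [|i j j_gt0 ltji lein].
  by rewrite expn_gt0.
(* The odd factor drops out, leaving [2 ^ e] to divide [i - j], where [0 < i - j < 2 ^ e]. *)
rewrite quadratic_diff Gauss_dvdzl; last first.
  have dE : d%:Z * (i%:Z + j%:Z) = 2 * (d./2%:Z * (i%:Z + j%:Z)).
    by rewrite mulrA; congr (_ * _); lia.
  by rewrite dE coprimezE /= coprimeXl // coprime2n; lia.
by apply/negP; rewrite dvdzE => /dvdn_leq /=; lia.
Qed.

(** The coprimality hypothesis says that [d] is a power of two; it makes [d] and [2 * d] invertible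
    modulo the odd part of [m]. *)
Lemma discriminates_ge (n k m : nat) :
  (forall q, odd q -> coprime q d) -> (2 ^ k < n)%N ->
  discriminates f n m -> (2 ^ k.+1 <= m)%N.
Proof.
move=> co_d ltkn /discriminatesP[m_gt0 f_inj]; rewrite leqNgt; apply/negP => ltm.
have collision i j : (0 < j)%N -> (j < i)%N -> (i <= n)%N ->
    ~~ (m%:Z %| (i%:Z - j%:Z) * (d%:Z * (i%:Z + j%:Z) - 1))%Z.
  by rewrite -quadratic_diff; apply: f_inj.
have [q] := pfactor_coprime (isT : prime 2) m_gt0.
rewrite coprime2n; move: (logn 2 m) => a q_odd mE.
have [q1 | q_neq1] := eqVneq q 1%N.
  have lea : (a <= k)%N by rewrite -ltnS -(ltn_exp2l _ _ (isT : 1 < 2)%N); lia.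
  have lt2a : (2 ^ a < n)%N by apply: leq_ltn_trans ltkn; rewrite leq_exp2l.
  have := collision (1 + 2 ^ a)%N 1%N isT; rewrite mE q1 mul1n PoszD addrAC subrr.
  by rewrite add0r dvdz_mulr ?dvdzz //; have := expn_gt0 2 a; lia.
have q_gt2 : (2 < q)%N by lia.
have m_le : (m + 3 <= 2 * n)%N by move: ltm; rewrite expnS; lia.
case: a => [|a] in mE.
  (* Here [q = m <= 2 * n - 3], so the window from 3 ends by [2 * n - 1]. *)
  have [s /andP[s_ge s_lt] q_dvd] :=
    linear_cong_window q d 1 3 (ltnW (ltnW q_gt2)) (co_d _ q_odd).
  have [i [j [j_gt0 ltji lein sE]]] :
      exists i j, [/\ (0 < j)%N, (j < i)%N, (i <= n)%N & s = (i + j)%N].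
    case: (leqP s n.+1) => ltsn; first by exists s.-1, 1%N; split; lia.
    by exists n, (s - n)%N; split; lia.
  have := collision i j j_gt0 ltji lein.
  by rewrite -PoszD -sE mE expn0 muln1 dvdz_mull.
have co_q2d : coprime q (2 * d) by rewrite coprimeMr coprimen2 q_odd co_d.
(* This is [d * (i + j) = 1] modulo [q] with [i = j + 2 ^ a.+1]; the window gives [1 <= j <= q]. *)
have [j /andP[j_ge j_lt] q_dvd] :=
  linear_cong_window q (2 * d) (1 - d%:Z * (2 ^ a.+1)%N%:Z) 1
    (ltnW (ltnW q_gt2)) co_q2d.
have pow_even : (2 ^ a.+1 = 2 * 2 ^ a)%N by rewrite expnS.
have pow_gt0 : (0 < 2 ^ a)%N by rewrite expn_gt0.
(* Expanding [(2 ^ a.+1 - 2) * (q - 2) >= 0] gives [2 * (2 ^ a.+1 + q) <= m + 4 <= 2 * n + 1];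
   parity does the rest. *)
have pow_le : (2 ^ a.+1 + q <= n)%N by nia.
have := collision (j + 2 ^ a.+1)%N j; rewrite mE.
have -> : (j + 2 ^ a.+1)%N%:Z - j%:Z = (2 ^ a.+1)%N%:Z by rewrite PoszD; ring.
have -> : d%:Z * ((j + 2 ^ a.+1)%N%:Z + j%:Z) - 1
        = (2 * d)%N%:Z * j%:Z - (1 - d%:Z * (2 ^ a.+1)%N%:Z).
  rewrite PoszD PoszM; ring.
have -> : (q * 2 ^ a.+1)%N%:Z = (2 ^ a.+1)%N%:Z * q%:Z by rewrite mulnC PoszM.
by case/(_ _ _ _)/negP; first [lia | apply: dvdz_mul; rewrite ?dvdzz].
Qed.

End Quadratic.

(* [up_log 2 n] is the least e with n <= 2 ^ e, i.e. the ceiling of log_2 n *)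
Theorem theorem2 (r d : nat) (f : {poly int})
    (hr : (0 < r)%N) (hd : d = (2 ^ r)%N)
    (hf : f = 'X * (d%:Z *: 'X - 1)) (n : nat) (hn : (0 < n)%N) :
  discriminator f n = Some (2 ^ up_log 2 n)%N.
Proof.
have d_even : ~~ odd d by rewrite hd oddX; lia.
have co_d q : odd q -> coprime q d by rewrite hd => q_odd; rewrite coprimeXr ?coprimen2.
have pow_disc : discriminates f n (2 ^ up_log 2 n).
  by rewrite hf; apply: discriminates_pow2 => //; apply: up_logP.
rewrite /discriminator; case: pselect => [exm | []]; last by exists (2 ^ up_log 2 n)%N.
congr Some; case: ex_minnP => m m_disc /(_ _ pow_disc) le_m.
apply/eqP; rewrite eqn_leq le_m /=.
(* For [n = 1] the exponent is 0 and has no predecessor to serve as [k] in the lower bound. *)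
have [n_le1 | n_gt1] := leqP n 1.
  have -> : n = 1%N by lia.
  by rewrite up_log1; case/andP: m_disc.
have /andP[lt_n _] := up_log_bounds (isT : 1 < 2)%N n_gt1.
rewrite -(prednK (_ : 0 < up_log 2 n)%N) ?up_log_gt0 //.
by move: m_disc; rewrite hf; apply: discriminates_ge.
Qed.
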